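(* Let $k<l<m<n$. Suppose $\Psi\in\mathbf{R}^{m\times n}$ has rank $m$, and $\mathcal{R}\in\mathbf{R}^{l\times m}$ has entries that are i.i.d. Gaussian random variables. Define $\Psi^{r}=\mathcal{R}\Psi$. Let $\omega_i$ be a coarse neighborhood with $n$ local fine-scale basis functions, and let $U$, $\Lambda$, $\lambda_{k+1}$, $\mathcal{H}$, $\mathcal{S}$, $\mathcal{H}^{(-1)}$ be the quantities defined from $\Psi$, $\mathcal{R}$, $\omega_i$ in the context. Then for any $\xi\in\mathbf{R}^{m}$ there exists $\xi^{r}\in\mathbf{R}^{l}$ such that $$\left\|\xi^{T}\Psi-(\xi^{r})^{T}\Psi^{r}\right\|_{\widetilde{M}(\omega_i)}^{2}=\int_{\omega_i}\widetilde{\kappa}\,\left|\xi^{T}\Psi-(\xi^{r})^{T}\Psi^{r}\right|^2\le C\left(\frac{\left\|\mathcal{H}^{(-1)}\mathcal{S}\right\|+1}{\lambda_{k+1}}\right)^2\left\|\xi^{T}\Psi\right\|_{A(\omega_i)}^2,$$ where the constant $C$ is independent of the size ratio between the coarse and fine meshes and of the spatial scales.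
   Context: Setting: $D\subset\mathbf{R}^2$ is a domain, and $\kappa(x)$ is a positive coefficient with multiple scales and high variations, arising in the elliptic equation $-\mathrm{div}(\kappa\nabla u)=f$ in $D$. $\mathcal{T}^H$ is a conforming coarse partition of $D$ into elements $K_j$ with vertices $x_i$, and $\mathcal{T}^h$ is a fine conforming triangulation refining it. The coarse neighborhood of $x_i$ is $\omega_i=\bigcup\{K_j\in\mathcal{T}^H : x_i\in\overline{K}_j\}$. The weight is $\widetilde{\kappa}=\sum_i\kappa|\nabla\chi_i^{+}|^2$, where $\chi_i^{+}$ are multiscale partition of unity functions. Let $\phi_1,\dots,\phi_n$ be the local fine-scale finite element basis functions in $\omega_i$, and put $$A(\omega_i)=\left(\int_{\omega_i}\kappa\nabla\phi_j\cdot\nabla\phi_k\right)_{n\times n},\qquad \widetilde{M}(\omega_i)=\left(\int_{\omega_i}\widetilde{\kappa}\,\phi_j\phi_k\right)_{n\times n}.$$ $A(\omega_i)$ is symmetric positive semidefinite and $\widetilde{M}(\omega_i)$ is symmetric positive definite. A row vector $z\in\mathbf{R}^n$ is identified with the function $\sum_j z_j\phi_j$ on $\omega_i$, and for such $z$, $$\|z\|_{\widetilde{M}(\omega_i)}=\left(\int_{\omega_i}\widetilde{\kappa}z^2\right)^{1/2},\qquad \|z\|_{A(\omega_i)}=\left(\int_{\omega_i}\kappa\nabla z\cdot\nabla z\right)^{1/2}.$$ The unadorned norm $\|\cdot\|$ is the $l^2$ norm for vectors and the spectral norm for matrices. (In the application, the rows of $\Psi$ are the local snapshots on $\omega_i$: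 restrictions to $\omega_i$ of discrete solutions of $-\mathrm{div}(\kappa\nabla\psi)=0$ in an oversampled region $\omega_i^+\supset\omega_i$ with boundary values equal to fine-grid nodal delta functions on $\partial\omega_i^+$.) Definition of $U,\Lambda,\lambda_j$: $U$ is an $m\times m$ matrix such that $$U^{T}\Psi\widetilde{M}(\omega_i)\Psi^{T}U=\Lambda,\qquad U^{T}\Psi A(\omega_i)\Psi^{T}U=I,$$ where $I$ is the identity and $\Lambda$ is diagonal with decreasing diagonal values $\frac1{\lambda_1},\frac1{\lambda_2},\dots,\frac1{\lambda_m}$. Definition of $\mathcal{H},\mathcal{S}$: $\mathcal{R}U^{-T}=(\mathcal{H}\ \ \mathcal{S})$, where $\mathcal{H}$ is $l\times k$ and consists of the first $k$ columns of $\mathcal{R}U^{-T}$, and $\mathcal{S}$ is $l\times(m-k)$. $\mathcal{H}$ is of rank $k$, and $\mathcal{H}^{(-1)}=(\mathcal{H}^{T}\mathcal{H})^{-1}\mathcal{H}^{T}$ is its pseudo-inverse.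
   Formalization: The constant C may depend on an upper bound L for λ_{k+1} (the bound with 1/λ_{k+1}² and C independent of the size ratio fails when λ_{k+1} is unbounded); the χ_i^+ are taken affine on each fine triangle and κ integrable on D. *)

(* Defs.v *)
From HB Require Import structures.
From mathcomp Require Import all_boot all_order all_algebra.
From mathcomp Require Import all_classical all_reals all_analysis.
Import Order.TTheory GRing.Theory Num.Theory.
Import numFieldNormedType.Exports.

Set Implicit Arguments.
Unset Strict Implicit.
Unset Printing Implicit Defensive.

Local Open Scope classical_set_scope.
Local Open Scope ring_scope.

(* A mesh is given combinatorially: each element is the set of its vertices.  *)
Record mesh (R : realType) := Mesh {
  nvert : nat;
  vert : 'I_nvert -> R * R;
  elements : {set {set 'I_nvert}} }.

Section geometry.
Context {R : realType}.
Implicit Types (D : set (R * R)) (T : mesh R).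

Definition hull T (S : {set 'I_(nvert T)}) : set (R * R) :=
  [set x | exists w : 'I_(nvert T) -> R,
    [/\ forall i, 0 <= w i, \sum_(i in S) w i = 1 &
        x = \sum_(i in S) w i *: vert i]].

(* The element is the open convex polygon; its closure is hull K. *)
Definition elt T (K : {set 'I_(nvert T)}) : set (R * R) := (hull K)°.

Definition domain D := [/\ open D, connected D & D !=set0].

(* Elements are convex polygons (triangles, quadrilaterals, and so on).  The  *)
(* last clause is conformity: two closed elements meet in the hull of their   *)
(* common vertices, i.e. in nothing, in a common vertex or in a common edge.  *)
Definition conforming_partition D T : Prop :=
  [/\ injective (@vert R T) /\
        (forall i, exists2 K, K \in elements T & i \in K),
      (forall K, K \in elements T ->
        elt K !=set0 /\ forall i, i \in K -> ~ hull (K :\ i) (vert i)),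
      (forall K, K \in elements T -> elt K `<=` D),
      closure D = \bigcup_(K in [set` elements T]) hull K &
      forall K K', K \in elements T -> K' \in elements T -> K != K' ->
        elt K `&` elt K' = set0 /\ hull K `&` hull K' = hull (K :&: K')].

Definition triangulation D T : Prop :=
  conforming_partition D T /\ forall K, K \in elements T -> #|K| = 3%N.

Definition refines (Th TH : mesh R) : Prop :=
  forall t, t \in elements Th ->
    exists2 K, K \in elements TH & hull t `<=` hull K.

Definition neighborhood T (i : 'I_(nvert T)) : set (R * R) :=
  \bigcup_(K in [set K | K \in elements T /\ closure (elt K) (vert i)]) elt K.

Definition affine_on (A : set (R * R)) (f : R * R -> R) : Prop :=
  exists a b c : R, forall x, A x -> f x = a + b * x.1 + c * x.2.

(* Continuous piecewise linear nodal basis function of v; continuity on the  *)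
(* closed domain follows from affinity on the closed triangles.              *)
Definition nodal_basis T (v : 'I_(nvert T)) (f : R * R -> R) : Prop :=
  (forall t, t \in elements T -> affine_on (hull t) f) /\
  (forall v', f (vert v') = (v' == v)%:R).

(* Elementwise gradient: the classical one inside the triangles, 0 on the     *)
(* skeleton of the mesh, which is Lebesgue-negligible.                        *)
Definition grad T (f : R * R -> R) (x : R * R) : R * R :=
  if `[< exists2 t, t \in elements T & elt t x >]
  then ('D_((1, 0) : R * R) f x, 'D_((0, 1) : R * R) f x)
  else (0, 0).

Definition dot (u v : R * R) : R := u.1 * v.1 + u.2 * v.2.

(* Partition of unity by fine-scale functions.  Jumps across edges are        *)
(* allowed since oversampled multiscale functions need not be conforming.     *)
Definition fine_partition_of_unity (Th : mesh R) (I : finType)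
    (chi : I -> R * R -> R) : Prop :=
  forall t, t \in elements Th ->
    (forall i, affine_on (elt t) (chi i)) /\
    (forall x, elt t x -> \sum_i chi i x = 1).

Definition kappa_tilde (Th : mesh R) (I : finType) (chi : I -> R * R -> R)
    (kappa : R * R -> R) (x : R * R) : R :=
  \sum_i kappa x * dot (grad Th (chi i) x) (grad Th (chi i) x).

Definition leb2 := ((@lebesgue_measure R) \x (@lebesgue_measure R))%E.

Definition stiffness (Th : mesh R) (omega : set (R * R)) (kappa : R * R -> R)
    n (phi : 'I_n -> R * R -> R) : 'M[R]_n :=
  \matrix_(j, k) \int[leb2]_(x in omega)
    (kappa x * dot (grad Th (phi j) x) (grad Th (phi k) x)).

Definition mass (omega : set (R * R)) (kt : R * R -> R)
    n (phi : 'I_n -> R * R -> R) : 'M[R]_n :=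
  \matrix_(j, k) \int[leb2]_(x in omega) (kt x * (phi j x * phi k x)).

Definition fe_fun n (phi : 'I_n -> R * R -> R) (z : 'rV[R]_n) (x : R * R) : R :=
  \sum_j z 0 j * phi j x.

Definition norm_M (omega : set (R * R)) (kt : R * R -> R)
    n (phi : 'I_n -> R * R -> R) (z : 'rV[R]_n) : R :=
  Num.sqrt (\int[leb2]_(x in omega) (kt x * (fe_fun phi z x) ^+ 2)).

Definition norm_A (Th : mesh R) (omega : set (R * R)) (kappa : R * R -> R)
    n (phi : 'I_n -> R * R -> R) (z : 'rV[R]_n) : R :=
  Num.sqrt (\int[leb2]_(x in omega)
    (kappa x * dot (grad Th (fe_fun phi z) x) (grad Th (fe_fun phi z) x))).

End geometry.

Section linear_algebra.
Context {R : realType}.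

Definition posdef n (M : 'M[R]_n) : Prop :=
  M^T = M /\ forall z : 'rV[R]_n, z != 0 -> 0 < (z *m M *m z^T) 0 0.

Definition l2norm n (v : 'cV[R]_n) : R := Num.sqrt (\sum_i v i 0 ^+ 2).

Definition spectral_norm m n (B : 'M[R]_(m, n)) : R :=
  sup [set l2norm (B *m v) | v in [set v | l2norm v <= 1]].

Definition pseudo_inverse m n (H : 'M[R]_(m, n)) : 'M[R]_(n, m) :=
  invmx (H^T *m H) *m H^T.

End linear_algebra.

Section probability.
Context {R : realType} d {Omega : measurableType d} {P : probability Omega R}.

Definition mutually_independent (I : finType) (X : I -> {RV P >-> R}) : Prop :=
  forall (J : {set I}) (B : I -> set R), (forall i, measurable (B i)) ->
    P (\bigcap_(i in [set` J]) (X i @^-1` B i)) =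
    (\prod_(i in J) P (X i @^-1` B i))%E.

Definition iid_gaussian (I : finType) (X : I -> {RV P >-> R}) : Prop :=
  mutually_independent X /\
  exists mean sigma : R, 0 < sigma /\
    forall i (B : set R), measurable B ->
      distribution P (X i) B = normal_prob mean sigma B.

Definition realization l m (X : 'I_l * 'I_m -> {RV P >-> R}) (w : Omega) :
  'M[R]_(l, m) := \matrix_(i, j) X (i, j) w.

End probability.

(* Main.v *)
Require Import Defs.
From HB Require Import structures.
From mathcomp Require Import all_boot all_order all_algebra.
From mathcomp Require Import all_classical all_reals all_analysis.
Import Order.TTheory GRing.Theory Num.Theory.
Import numFieldNormedType.Exports.
Local Open Scope classical_set_scope.
Local Open Scope ring_scope.
From mathcomp Require Import measurable_realfun ring lra.

(** The rows of Phi = U^T Psi diagonalize both forms at once: they are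
    A-orthonormal and M-orthogonal, with squared M-norms 1/lambda_j decreasing
    in j. Write xi^T Psi = a^T Phi with a = U^-1 xi, and split a into its first
    k coordinates a1 and the others a2. A random combination of snapshots is
    xir^T R Psi = xir^T (H S) Phi, so the choice xir^T = a1^T H^(-1)
    reproduces a1 exactly, because H^(-1) H = I when H has full column rank. The
    error has then no component on the k leading modes; it is r^T Phi2, where
    Phi2 collects the last q rows of Phi and r = a2 - (H^(-1) S)^T a1. Hence
      |error|_M^2 <= (1/lambda_(k+1)) |r|^2
                  <= (1/lambda_(k+1)) (|H^(-1) S| + 1)^2 |a|^2,
    and |a|^2 is the squared A-norm of xi^T Psi. This is
    [randomized_truncation].

    The bound to be proved has 1/lambda_(k+1)^2 instead of 1/lambda_(k+1); the
    missing factor lambda_(k+1) is at most L, whence C = max(L, 1), where the 1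
    keeps C positive. The positivity of lambda_(k+1) comes from M being positive
    definite ([posdef_diag_gt0]).

    What remains is to identify the integrals of finite element functions with
    the quadratic forms of the stiffness and mass matrices ([sqr_norm_A],
    [Rintegral_mass]), that is, to expand the integral of a double sum. This
    asks for every entry to be integrable. Each integrand is kappa,
    integrable by hypothesis, times a function that is measurable and bounded:
    the gradients are constant on each fine triangle and 0 on the skeleton,
    and the nodal functions take values in [-1, 1]. *)

Set Implicit Arguments.
Unset Strict Implicit.

(** * Euclidean and spectral norms *)

Lemma l2norm_ge0 (R : realType) n (v : 'cV[R]_n) : 0 <= l2norm v.
Proof. exact: sqrtr_ge0. Qed.

Lemma sqr_l2norm (R : realType) n (v : 'cV[R]_n) :
  l2norm v ^+ 2 = \sum_i v i 0 ^+ 2.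
Proof. by rewrite sqr_sqrtr// sumr_ge0// => i _; exact: sqr_ge0. Qed.

Lemma l2norm_mx (R : realType) n (v : 'cV[R]_n) :
  l2norm v ^+ 2 = (v^T *m v) 0 0.
Proof. by rewrite sqr_l2norm mxE; apply: eq_bigr => i _; rewrite mxE expr2. Qed.

Lemma l2norm0 (R : realType) n : l2norm (0 : 'cV[R]_n) = 0.
Proof.
by apply/eqP; rewrite -sqrf_eq0 sqr_l2norm big1// => i _; rewrite mxE expr0n.
Qed.

Lemma l2norm_eq0 (R : realType) n (v : 'cV[R]_n) : l2norm v = 0 -> v = 0.
Proof.
move=> /eqP; rewrite -sqrf_eq0 sqr_l2norm psumr_eq0 => [|i _]; last exact: sqr_ge0.
move=> /allP v0; apply/matrixP => i j; rewrite mxE ord1; apply/eqP.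
by rewrite -sqrf_eq0; apply: v0; rewrite mem_index_enum.
Qed.

Lemma l2normZ (R : realType) n (c : R) (v : 'cV[R]_n) :
  0 <= c -> l2norm (c *: v) = c * l2norm v.
Proof.
move=> c0; apply/eqP; rewrite -(@eqrXn2 _ 2)//.
- by rewrite exprMn !sqr_l2norm mulr_sumr; apply/eqP/eq_bigr => i _;
  rewrite mxE exprMn.
- exact: l2norm_ge0.
- by rewrite mulr_ge0// l2norm_ge0.
Qed.

Lemma l2normN (R : realType) n (v : 'cV[R]_n) : l2norm (- v) = l2norm v.
Proof. by congr Num.sqrt; apply: eq_bigr => i _; rewrite mxE sqrrN. Qed.

Lemma cauchy_schwarz_l2norm (R : realType) n (x y : 'cV[R]_n) :
  (x^T *m y) 0 0 <= l2norm x * l2norm y.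
Proof.
have [y0|yn0] := eqVneq (l2norm y) 0.
  by rewrite (l2norm_eq0 y0) mulmx0 mxE l2norm0 mulr0.
set c := (x^T *m y) 0 0; set Q := l2norm y ^+ 2.
have Q0 : 0 < Q by rewrite exprn_gt0// lt0r yn0 l2norm_ge0.
rewrite (le_trans (ler_norm _))// -(@ler_pXn2r _ 2) ?nnegrE//; last first.
  by rewrite mulr_ge0 ?l2norm_ge0.
rewrite real_normK ?num_real// exprMn -/Q.
(* the vector |y|^2 x - <x, y> y is |y|^2 times the part of x orthogonal to y *)
have : 0 <= \sum_i (Q * x i 0 - c * y i 0) ^+ 2.
  by apply: sumr_ge0 => i _; exact: sqr_ge0.
have -> : \sum_i (Q * x i 0 - c * y i 0) ^+ 2 = Q * (l2norm x ^+ 2 * Q - c ^+ 2).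
  under eq_bigr do rewrite sqrrB !exprMn.
  rewrite big_split/= sumrB -!mulr_sumr -!sqr_l2norm -/Q.
  have -> : \sum_i (Q * x i 0 * (c * y i 0)) *+ 2 = (Q * c) *+ 2 * c.
    rewrite {3}/c mxE mulr_sumr; apply: eq_bigr => i _.
    by rewrite mxE; ring.
  by ring.
by rewrite pmulr_rge0// subr_ge0.
Qed.

Lemma l2normB (R : realType) n (x y : 'cV[R]_n) :
  l2norm (x - y) <= l2norm x + l2norm y.
Proof.
rewrite -(@ler_pXn2r _ 2) ?nnegrE ?addr_ge0 ?l2norm_ge0//.
have -> : l2norm (x - y) ^+ 2 =
    l2norm x ^+ 2 + l2norm y ^+ 2 + (x^T *m - y) 0 0 *+ 2.
  rewrite !sqr_l2norm mxE -sumrMnl -!big_split/=.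
  by apply: eq_bigr => i _; rewrite !mxE; ring.
by have := cauchy_schwarz_l2norm x (- y); rewrite l2normN; nra.
Qed.

(** A supremum of reals means something only once the set is bounded; the
    Frobenius norm is a bound, by Cauchy-Schwarz on each row. *)
Lemma has_ubound_spectral_norm (R : realType) m n (B : 'M[R]_(m, n)) :
  has_ubound [set l2norm (B *m v) | v in [set v | l2norm v <= 1]].
Proof.
exists (Num.sqrt (\sum_i l2norm (row i B)^T ^+ 2)) => _ [v /= v1 <-].
rewrite ler_wsqrtr//; apply: ler_sum => i _.
have -> : (B *m v) i 0 = ((row i B)^T^T *m v) 0 0.
  by rewrite trmxK -row_mul [RHS]mxE.
rewrite -real_normK ?num_real// ler_pXn2r ?nnegrE ?l2norm_ge0//.
have Bv (w : 'cV[R]_n) : l2norm w <= 1 ->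
    ((row i B)^T^T *m w) 0 0 <= l2norm (row i B)^T.
  move=> w1; apply: le_trans (cauchy_schwarz_l2norm _ _) _.
  by rewrite ler_piMr ?l2norm_ge0.
rewrite ler_norml Bv// andbT lerNl.
have -> : - ((row i B)^T^T *m v) 0 0 = ((row i B)^T^T *m - v) 0 0.
  by rewrite mulmxN [RHS]mxE.
by apply: Bv; rewrite l2normN.
Qed.

Lemma spectral_norm_ge0 (R : realType) m n (B : 'M[R]_(m, n)) :
  0 <= spectral_norm B.
Proof.
apply: ub_le_sup; first exact: has_ubound_spectral_norm.
by exists 0; rewrite ?mulmx0 /= l2norm0.
Qed.

Lemma l2norm_mulmx (R : realType) m n (B : 'M[R]_(m, n)) (v : 'cV[R]_n) :
  l2norm (B *m v) <= spectral_norm B * l2norm v.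
Proof.
have [v0|vn0] := eqVneq (l2norm v) 0.
  by rewrite (l2norm_eq0 v0) mulmx0 !l2norm0 mulr0.
have vgt0 : 0 < l2norm v by rewrite lt0r vn0 l2norm_ge0.
rewrite -ler_pdivrMr// mulrC -l2normZ ?invr_ge0 ?l2norm_ge0// scalemxAr.
apply: ub_le_sup; first exact: has_ubound_spectral_norm.
by exists ((l2norm v)^-1 *: v); rewrite //= l2normZ ?invr_ge0 ?l2norm_ge0// mulVf.
Qed.

(** Transposing does not increase the spectral norm:
    |B^T v|^2 = <v, B B^T v> <= |v| |B| |B^T v|. *)
Lemma l2norm_trmx_mulmx (R : realType) m n (B : 'M[R]_(m, n)) (v : 'cV[R]_m) :
  l2norm (B^T *m v) <= spectral_norm B * l2norm v.
Proof.
set w := B^T *m v.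
have [w0|wn0] := eqVneq (l2norm w) 0.
  by rewrite w0 mulr_ge0 ?spectral_norm_ge0 ?l2norm_ge0.
have wgt0 : 0 < l2norm w by rewrite lt0r wn0 l2norm_ge0.
rewrite -(ler_pM2r wgt0) -expr2 l2norm_mx {1}/w trmx_mul trmxK -mulmxA.
apply: le_trans (cauchy_schwarz_l2norm _ _) _.
by rewrite (mulrC (l2norm v)) mulrAC ler_wpM2r ?l2norm_ge0// l2norm_mulmx.
Qed.

(** * Truncation in the simultaneous eigenbasis *)

(** The Gram matrix of independent columns is invertible: if v H^T H = 0 then
    |H v^T|^2 = v H^T H v^T = 0. *)
Lemma pseudo_inverseK (R : realType) l k (H : 'M[R]_(l, k)) :
  \rank H = k -> pseudo_inverse H *m H = 1%:M.
Proof.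
move=> rH; rewrite /pseudo_inverse -mulmxA mulVmx// -row_free_unit.
apply: inj_row_free => v vHH.
have HtV : v *m H^T = 0.
  apply: trmx_inj; rewrite trmx0; apply: l2norm_eq0; apply/eqP.
  by rewrite -sqrf_eq0 l2norm_mx trmxK trmx_mul trmxK mulmxA -(mulmxA v) vHH
             mul0mx mxE.
have /row_free_inj : row_free H^T by rewrite /row_free mxrank_tr rH.
by apply; rewrite HtV mul0mx.
Qed.

Lemma quad_diag_mx (R : comNzRingType) n (c e : 'rV[R]_n) :
  (c *m diag_mx e *m c^T) 0 0 = \sum_j e 0 j * c 0 j ^+ 2.
Proof.
rewrite mul_mx_diag mxE; apply: eq_bigr => j _.
by rewrite !mxE; ring.
Qed.

(** The combination xir is chosen to cancel the k leading modes, so the error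
    only sees the entries of e beyond k, which c bounds. In the application e
    lists the 1/lambda_j and c is 1/lambda_(k+1). *)
Lemma randomized_truncation (R : realType) (k q l n : nat)
    (Psi : 'M[R]_(k + q, n)) (U : 'M[R]_(k + q)) (M A : 'M[R]_n)
    (e : 'rV[R]_(k + q)) (c : R) (Rw : 'M[R]_(l, k + q))
    (H := lsubmx (Rw *m (invmx U)^T) : 'M[R]_(l, k))
    (S := rsubmx (Rw *m (invmx U)^T) : 'M[R]_(l, q)) :
  U^T *m Psi *m M *m Psi^T *m U = diag_mx e ->
  U^T *m Psi *m A *m Psi^T *m U = 1%:M ->
  0 <= c -> (forall j : 'I_q, e 0 (rshift k j) <= c) ->
  \rank H = k ->
  forall xi : 'cV[R]_(k + q), exists xir : 'cV[R]_l,
    let z := xi^T *m Psi - xir^T *m (Rw *m Psi) in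
    (z *m M *m z^T) 0 0 <=
      c * (spectral_norm (pseudo_inverse H *m S) + 1) ^+ 2
        * (xi^T *m Psi *m A *m (xi^T *m Psi)^T) 0 0.
Proof.
move=> UMU UAU c0 ec rH xi.
have Uu : U \in unitmx by case: (mulmx1_unit UAU).
have VU : (invmx U)^T *m U^T = 1%:M by rewrite -trmx_mul mulmxV// trmx1.
pose a := invmx U *m xi; pose a1 := usubmx a; pose a2 := dsubmx a.
pose Phi := U^T *m Psi.
have xiE : xi^T *m Psi = a^T *m Phi.
  by rewrite /a /Phi trmx_mul mulmxA -(mulmxA xi^T) VU mulmx1.
have RE : Rw *m Psi = row_mx H S *m Phi.
  by rewrite hsubmxK /Phi mulmxA -(mulmxA Rw) VU mulmx1.
have quad (B : 'M[R]_n) (v : 'rV[R]_(k + q)) :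
    v *m Phi *m B *m (v *m Phi)^T =
    v *m (U^T *m Psi *m B *m Psi^T *m U) *m v^T.
  by rewrite /Phi !trmx_mul trmxK !mulmxA.
pose B := pseudo_inverse H *m S; pose r := a2 - B^T *m a1.
(* chosen so that its k leading coordinates agree with a1 *)
exists ((pseudo_inverse H)^T *m a1) => z.
have -> : z = row_mx 0 r^T *m Phi.
  rewrite /z xiE RE (trmx_mul _ a1) trmxK mulmxA -mulmxBl; congr (_ *m _).
  rewrite -{1}(vsubmxK a) tr_col_mx mul_mx_row opp_row_mx add_row_mx.
  rewrite -/a1 -mulmxA pseudo_inverseK// mulmx1 subrr.
  by rewrite /r linearB/= (trmx_mul B^T) trmxK /B
    (mulmxA a1^T (pseudo_inverse H)).
rewrite xiE !quad UMU UAU mulmx1 quad_diag_mx trmxK.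
rewrite -l2norm_mx big_split_ord/= big1 ?add0r; last first.
  by move=> j _; rewrite row_mxEl mxE expr0n mulr0.
have -> : c * (spectral_norm B + 1) ^+ 2 * l2norm a ^+ 2 =
          c * ((spectral_norm B + 1) * l2norm a) ^+ 2 by rewrite -mulrA -exprMn.
apply: (@le_trans _ _ (c * l2norm r ^+ 2)).
  rewrite sqr_l2norm mulr_sumr; apply: ler_sum => j _.
  by rewrite row_mxEr mxE ler_wpM2r ?sqr_ge0.
rewrite ler_wpM2l// ler_pXn2r ?nnegrE ?mulr_ge0 ?addr_ge0 ?l2norm_ge0
  ?spectral_norm_ge0//.
have aE : l2norm a ^+ 2 = l2norm a1 ^+ 2 + l2norm a2 ^+ 2.
  rewrite -{1}(vsubmxK a) !sqr_l2norm big_split_ord/=.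
  by congr (_ + _); apply: eq_bigr => j _; rewrite ?col_mxEu ?col_mxEd.
have a1a : l2norm a1 <= l2norm a.
  by rewrite -(@ler_pXn2r _ 2) ?nnegrE ?l2norm_ge0// aE lerDl sqr_ge0.
have a2a : l2norm a2 <= l2norm a.
  by rewrite -(@ler_pXn2r _ 2) ?nnegrE ?l2norm_ge0// aE lerDr sqr_ge0.
apply: le_trans (l2normB _ _) _; rewrite mulrDl mul1r addrC lerD//.
apply: le_trans (l2norm_trmx_mulmx _ _) _.
by rewrite ler_wpM2l ?spectral_norm_ge0.
Qed.

(** The diagonal entries are the squared M-norms of the rows of U^T Psi, which
    are linearly independent, hence nonzero. *)
Lemma posdef_diag_gt0 (R : realType) (m n : nat) (Psi : 'M[R]_(m, n))
    (U : 'M[R]_m) (M : 'M[R]_n) (e : 'rV[R]_m) :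
  posdef M -> \rank Psi = m -> U \in unitmx ->
  U^T *m Psi *m M *m Psi^T *m U = diag_mx e -> forall j, 0 < e 0 j.
Proof.
move=> [_ Mpos] rPsi Uu UMU j.
have Phifree : row_free (U^T *m Psi).
  rewrite /row_free mxrankMfree ?mxrank_tr ?mxrank_unit//.
  by rewrite /row_free rPsi.
have Phij : row j (U^T *m Psi) != 0.
  apply/eqP; rewrite rowE => /eqP; rewrite mulmx_free_eq0// => /eqP /matrixP.
  by move=> /(_ 0 j)/eqP; rewrite !mxE !eqxx oner_eq0.
have := Mpos _ Phij.
have -> : row j (U^T *m Psi) *m M *m (row j (U^T *m Psi))^T =
          row j (diag_mx e) *m delta_mx j (0 : 'I_1).
  by rewrite -UMU !rowE !trmx_mul trmx_delta trmxK !mulmxA.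
by rewrite -colE !mxE eqxx mulr1n.
Qed.

(** * Measurability and integrability in the plane *)

(** An open set is the union of the boxes with rational centre and radius
    1/(n+1) that it contains, and these boxes are countably many. *)
Lemma open_measurable2 (R : realType) (A : set (R * R)) :
  open A -> measurable (A : set (measurableTypeR R * measurableTypeR R)).
Proof.
move=> oA.
(* the box indexed by p if A contains it, the empty set otherwise *)
pose F (p : rat * rat * nat) : set (R * R) :=
  [set x | ball (ratr p.1.1 : R) (p.2.+1%:R^-1) `*`
           ball (ratr p.1.2 : R) (p.2.+1%:R^-1) `<=` A] `&`
  ball (ratr p.1.1 : R) (p.2.+1%:R^-1) `*` ball (ratr p.1.2 : R) (p.2.+1%:R^-1).
have -> : A = \bigcup_p F p.
  apply/seteqP; split => [x Ax|x [p _ [pA px]]]; last exact: pA.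
  have /nbhs_ballP[e /= e0 eA] : nbhs x A by exact: open_nbhs_nbhs.
  have [n ne] : exists n, n.+1%:R^-1 < e / 2.
    exists (Num.truncn (e / 2)^-1).
    rewrite invf_plt ?posrE// ?divr_gt0//.
    exact: truncnS_gt.
  have n0 : 0 < n.+1%:R^-1 :> R by rewrite invr_gt0.
  have rat_ball (u : R) : exists q : rat, ball (ratr q : R) n.+1%:R^-1 u.
    have [q] : exists q : rat, (ratr q : R) \in `](u - n.+1%:R^-1), u[.
      by apply: rat_in_itvoo; rewrite ltrBlDr ltrDl.
    rewrite in_itv/= => /andP[uq qu]; exists q.
    rewrite -ball_normE/= ltr_norml; move: n.+1%:R^-1 n0 uq => r r0 uq.
    by apply/andP; split; lra.
  have [a xa] := rat_ball x.1; have [b xb] := rat_ball x.2.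
  exists (a, b, n) => //; split; last by split.
  move=> y [ya yb]; apply: eA; split.
  - have := ball_triangle (ball_sym xa) ya; apply: le_ball; move: ne; set r := _^-1; lra.
  - have := ball_triangle (ball_sym xb) yb; apply: le_ball; move: ne; set r := _^-1; lra.
apply: countable_bigcupT_measurable => [|p].
  by apply: countableP.
rewrite /F; have [pA|pA] := pselect (ball (ratr p.1.1 : R) (p.2.+1%:R^-1) `*`
           ball (ratr p.1.2 : R) (p.2.+1%:R^-1) `<=` A).
  rewrite (_ : [set x | _] = setT) ?setTI; last by apply/seteqP; split.
  apply: measurableX; exact: measurable_realfun.measurable_ball.
rewrite (_ : [set x | _] = set0) ?set0I//; by apply/seteqP; split.
Qed.

(** The multipliers that keep an integrable function integrable. Bounds and
    measurability are asked on the whole plane, so that sums and products stay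
    in the class without any domain to track. *)
Definition bounded_measurable (R : realType) (f : R * R -> R) : Prop :=
  measurable_fun setT (f : measurableTypeR R * measurableTypeR R -> R) /\
  exists c : R, forall x, `|f x| <= c.

Lemma bounded_measurable_cst (R : realType) (a : R) :
  bounded_measurable (fun _ => a).
Proof. by split; [exact: measurable_cst | exists `|a|]. Qed.

Lemma bounded_measurableD (R : realType) (f g : R * R -> R) :
  bounded_measurable f -> bounded_measurable g ->
  bounded_measurable (fun x => f x + g x).
Proof.
move=> [mf [c fc]] [mg [b gb]]; split; first exact: measurable_funD.
by exists (c + b) => x; apply: le_trans (ler_normD _ _) _; exact: lerD.
Qed.

Lemma bounded_measurableM (R : realType) (f g : R * R -> R) :
  bounded_measurable f -> bounded_measurable g ->
  bounded_measurable (fun x => f x * g x).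
Proof.
move=> [mf [c fc]] [mg [b gb]]; split; first exact: measurable_funM.
by exists (c * b) => x; rewrite normrM; exact: ler_pM.
Qed.

Lemma bounded_measurable_sum (R : realType) (I : finType) (f : I -> R * R -> R) :
  (forall i, bounded_measurable (f i)) ->
  bounded_measurable (fun x => \sum_i f i x).
Proof.
move=> bf; elim: (index_enum I) => [|i s IHs].
  rewrite (_ : (fun _ => _) = fun _ => 0); first exact: bounded_measurable_cst.
  by apply/funext => x; rewrite big_nil.
rewrite (_ : (fun _ => _) = fun x => f i x + \sum_(j <- s) f j x).
  exact: bounded_measurableD.
by apply/funext => x; rewrite big_cons.
Qed.

Lemma integrable_bounded_measurable (R : realType) (D omega : set (R * R))
    (kappa h : R * R -> R) :
  measurable (D : set (measurableTypeR R * measurableTypeR R)) ->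
  measurable (omega : set (measurableTypeR R * measurableTypeR R)) ->
  omega `<=` D -> leb2.-integrable D (EFin \o kappa) -> bounded_measurable h ->
  leb2.-integrable omega (EFin \o (fun x => kappa x * h x)).
Proof.
move=> mD momega sD ik [mh [c hc]].
have := integrableS mD momega sD ik.
move=> /(integrableMl momega) /(_ (measurable_funTS mh)); apply.
exists c; split; first exact: num_real.
by move=> b cb x _; exact: le_trans (hc x) (ltW cb).
Qed.

(** Integrability and the value of the integral are proved together, since the
    induction step for the value uses the integrability of the tail. *)
Lemma Rintegral_sum (R : realType) d (T : measurableType d)
    (mu : {measure set T -> \bar R}) (D : set T) (I : Type) (s : seq I)
    (f : I -> T -> R) :
  measurable D -> (forall i, mu.-integrable D (EFin \o f i)) ->
  mu.-integrable D (EFin \o (fun x => \sum_(i <- s) f i x)) /\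
  \int[mu]_(x in D) (\sum_(i <- s) f i x) =
  \sum_(i <- s) \int[mu]_(x in D) f i x.
Proof.
move=> mD fi; elim: s => [|i s [IHi IHs]].
  rewrite big_nil (_ : (fun _ => _) = cst 0); last first.
    by apply/funext => x; rewrite big_nil.
  by split; [exact: integrable0|rewrite /Rintegral integral0].
rewrite big_cons (_ : (fun _ => _) = fun x => f i x + \sum_(j <- s) f j x).
  split; last by rewrite RintegralD// IHs.
  exact: (integrableD mD (fi i) IHi).
by apply/funext => x; rewrite big_cons.
Qed.

Lemma Rintegral_quad (R : realType) d (T : measurableType d)
    (mu : {measure set T -> \bar R}) (D : set T) n
    (F : 'I_n -> 'I_n -> T -> R) (z : 'rV[R]_n) :
  measurable D -> (forall j k, mu.-integrable D (EFin \o F j k)) ->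
  \int[mu]_(x in D) (\sum_j \sum_k z 0 j * z 0 k * F j k x) =
  (z *m (\matrix_(j, k) \int[mu]_(x in D) F j k x) *m z^T) 0 0.
Proof.
move=> mD Fi.
have zFi j k : mu.-integrable D (EFin \o (fun x => z 0 j * z 0 k * F j k x)).
  exact: (integrableZl mD (z 0 j * z 0 k) (Fi j k)).
rewrite (Rintegral_sum _ mD _).2; last first.
  by move=> j; exact: (Rintegral_sum _ mD _).1.
rewrite mxE; under [RHS]eq_bigr do rewrite mxE mulr_suml.
rewrite exchange_big/=; apply: eq_bigr => j _.
rewrite (Rintegral_sum _ mD _).2//; apply: eq_bigr => k _.
by rewrite !mxE RintegralZl//; ring.
Qed.

(** * Piecewise affine functions *)

Lemma derive_affine (R : realType) (a b c : R) (x v : R * R) :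
  'D_v (fun y : R * R => a + b * y.1 + c * y.2) x = b * v.1 + c * v.2.
Proof.
rewrite /derive; apply: cvg_lim => //; apply: cvg_near_cst.
near=> h; have h0 : h != 0 by near: h; exact: nbhs_dnbhs_neq.
rewrite /= /GRing.scale/=; field; exact: h0.
Unshelve. all: by end_near.
Qed.

Lemma grad_elt (R : realType) (Th : mesh R) (f : R * R -> R) (a b c : R)
    (t : {set 'I_(nvert Th)}) (x : R * R) :
  t \in elements Th -> (forall y, elt t y -> f y = a + b * y.1 + c * y.2) ->
  elt t x -> grad Th f x = (b, c).
Proof.
move=> tTh fE tx; rewrite /grad; case: asboolP => [_|]; last by case; exists t.
have fnear : {near x, f =1 fun y => a + b * y.1 + c * y.2}.
  have := open_nbhs_nbhs (conj (open_interior (hull t)) tx).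
  by apply: filterS => y; exact: fE.
by rewrite !(near_eq_derive _ fnear) !derive_affine/= !(mulr0, mulr1, addr0, add0r).
Qed.

Lemma grad_skeleton (R : realType) (Th : mesh R) (f : R * R -> R) (x : R * R) :
  ~ (exists2 t, t \in elements Th & elt t x) -> grad Th f x = (0, 0).
Proof. by move=> tx; rewrite /grad; case: asboolP. Qed.

Lemma measurable_elt (R : realType) (Th : mesh R) (t : {set 'I_(nvert Th)}) :
  measurable (elt t : set (measurableTypeR R * measurableTypeR R)).
Proof. by apply: open_measurable2; exact: open_interior. Qed.

(** Values off the open triangles are prescribed to be 0, so that the plane is
    cut into finitely many measurable pieces without any information on the
    skeleton. The witness h is global, which lets products of such functions
    be handled triangle by triangle. *)
Lemma piecewise_bounded_measurable (R : realType) (Th : mesh R)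
    (g : R * R -> R) :
  (forall t, t \in elements Th ->
    exists2 h, bounded_measurable h & forall x, elt t x -> g x = h x) ->
  (forall x, ~ (exists2 t, t \in elements Th & elt t x) -> g x = 0) ->
  bounded_measurable g.
Proof.
move=> gelt g0; split; last first.
  have /choice[c cP] t : exists c : R, t \in elements Th ->
      forall x, elt t x -> `|g x| <= c.
    have [tTh|_] := boolP (t \in elements Th); last by exists 0.
    have [h [_ [c hc]] gh] := gelt _ tTh.
    by exists c => _ x tx; rewrite gh.
  exists (\sum_t `|c t|) => x.
  have [[t tTh tx]|nx] := pselect (exists2 t, t \in elements Th & elt t x).
    apply: le_trans (cP _ tTh _ tx) _; apply: le_trans (ler_norm _) _.
    by rewrite (bigD1 t)//= lerDl sumr_ge0.
  by rewrite g0// normr0 sumr_ge0.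
pose U := \big[setU/set0]_(t <- enum (elements Th)) elt t.
have mU : measurable (U : set (measurableTypeR R * measurableTypeR R)).
  by apply: bigsetU_measurable => t _; exact: measurable_elt.
have UP x : U x <-> exists2 t, t \in elements Th & elt t x.
  rewrite /U -bigcup_seq; split => [[t /=]|[t tTh tx]].
    by rewrite mem_enum; exists t.
  by exists t; rewrite //= mem_enum.
rewrite -(setUv U); apply/measurable_funU => //; first exact: measurableC.
split; last first.
  apply: (@eq_measurable_fun _ _ _ _ _ (fun _ : R * R => 0 : R)) => [x|]; last exact: measurable_cst.
  by rewrite inE => nUx; rewrite g0// => /UP.
have : all (mem (elements Th)) (enum (elements Th)).
  by apply/allP => t; rewrite mem_enum.
move: @U mU UP => /= _ _; elim: (enum _) => [_|t s IHs /= /andP[tTh sTh]].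
  by rewrite big_nil; exact: measurable_fun_set0.
rewrite big_cons; apply/measurable_funU; first exact: measurable_elt.
  by apply: bigsetU_measurable => u _; exact: measurable_elt.
split; last exact: IHs.
have [h [mh _] gh] := gelt _ tTh.
apply: (@eq_measurable_fun _ _ _ _ _ h) => [x|]; last exact: measurable_funTS.
by rewrite inE => /gh.
Qed.

Lemma grad_bounded_measurable (R : realType) (Th : mesh R) (f : R * R -> R) :
  (forall t, t \in elements Th -> affine_on (elt t) f) ->
  bounded_measurable (fun x => (grad Th f x).1) /\
  bounded_measurable (fun x => (grad Th f x).2).
Proof.
move=> faff; split; apply: (@piecewise_bounded_measurable _ Th) => [t tTh|x nx].
- have [a [b [c fE]]] := faff _ tTh.
  exists (fun=> b) => [|x tx]; first exact: bounded_measurable_cst.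
  by rewrite (grad_elt tTh fE tx).
- by rewrite grad_skeleton.
- have [a [b [c fE]]] := faff _ tTh.
  exists (fun=> c) => [|x tx]; first exact: bounded_measurable_cst.
  by rewrite (grad_elt tTh fE tx).
- by rewrite grad_skeleton.
Qed.

Lemma dot_grad_bounded_measurable (R : realType) (Th : mesh R)
    (f g : R * R -> R) :
  (forall t, t \in elements Th -> affine_on (elt t) f) ->
  (forall t, t \in elements Th -> affine_on (elt t) g) ->
  bounded_measurable (fun x => dot (grad Th f x) (grad Th g x)).
Proof.
move=> /grad_bounded_measurable[f1 f2] /grad_bounded_measurable[g1 g2].
by apply: bounded_measurableD; exact: bounded_measurableM.
Qed.

(** The identity holds at every point, not merely almost everywhere: on the
    skeleton both sides vanish by convention. *)
Lemma grad_fe_fun (R : realType) (Th : mesh R) n (phi : 'I_n -> R * R -> R)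
    (z : 'rV[R]_n) (x : R * R) :
  (forall j t, t \in elements Th -> affine_on (elt t) (phi j)) ->
  grad Th (fe_fun phi z) x =
  (\sum_j z 0 j * (grad Th (phi j) x).1, \sum_j z 0 j * (grad Th (phi j) x).2).
Proof.
move=> phiaff.
have [[t tTh tx]|nx] := pselect (exists2 t, t \in elements Th & elt t x).
  have /choice[a /choice[b /choice[c phiE]]] :
      forall j, exists a b c : R, forall y, elt t y ->
        phi j y = a + b * y.1 + c * y.2.
    by move=> j; exact: phiaff.
  rewrite (@grad_elt _ _ _ (\sum_j z 0 j * a j) (\sum_j z 0 j * b j)
    (\sum_j z 0 j * c j) _ _ tTh _ tx); last first.
    move=> y ty; rewrite !mulr_suml -!big_split/=; apply: eq_bigr => j _.
    by rewrite (phiE j _ ty); ring.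
  by congr pair; apply: eq_bigr => j _; rewrite (grad_elt tTh (phiE j) tx).
rewrite grad_skeleton//; congr pair; rewrite big1// => j _;
  by rewrite grad_skeleton//= mulr0.
Qed.

(** An affine function at a convex combination of vertices is the same
    combination of its nodal values, here 0 and 1. *)
Lemma nodal_basis_le1 (R : realType) (Th : mesh R) (v : 'I_(nvert Th))
    (f : R * R -> R) (t : {set 'I_(nvert Th)}) (x : R * R) :
  nodal_basis v f -> t \in elements Th -> hull t x -> `|f x| <= 1.
Proof.
move=> [faff fvert] tTh tx; have [w [w0 w1 xE]] := tx.
have [a [b [c fE]]] := faff _ tTh.
have vt i : i \in t -> hull t (vert i).
  move=> it; exists (fun j => (j == i)%:R); split.
  - by move=> j; rewrite ler0n.
  - by rewrite (bigD1 i)//= eqxx big1 ?addr0// => j /andP[_ /negPf->].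
  - rewrite (bigD1 i)//= eqxx scale1r big1 ?addr0// => j /andP[_ /negPf->].
    by rewrite scale0r.
have -> : f x = \sum_(i in t) w i * (i == v)%:R.
  transitivity (\sum_(i in t) w i * f (vert i)); last first.
    by apply: eq_bigr => i _; rewrite fvert.
  have x1 : x.1 = \sum_(i in t) w i * (vert i).1.
    by rewrite xE (big_morph fst (id1 := 0) (op1 := +%R)).
  have x2 : x.2 = \sum_(i in t) w i * (vert i).2.
    by rewrite xE (big_morph snd (id1 := 0) (op1 := +%R)).
  rewrite fE// -[a]mulr1 -w1 x1 x2 !mulr_sumr -!big_split/=.
  by apply: eq_bigr => i it; rewrite (fE _ (vt _ it)); ring.
apply: le_trans (ler_norm_sum _ _ _) _; rewrite -[leRHS]w1; apply: ler_sum => i _.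
rewrite normrM (ger0_norm (w0 i)) ler_piMr//.
by case: (_ == _); rewrite ?normr0 ?normr1.
Qed.

Lemma affine_bounded_measurable_restrict (R : realType) (Th : mesh R)
    (f : R * R -> R) (t : {set 'I_(nvert Th)}) :
  affine_on (elt t) f -> (exists c, forall x, elt t x -> `|f x| <= c) ->
  exists2 h, bounded_measurable h & forall x, elt t x -> f x = h x.
Proof.
move=> [a [b [c fE]]] [d fd].
exists (f \_ (elt t)) => [|x tx]; last by rewrite patchT// inE.
split; last first.
  exists `|d| => x; rewrite patchE; case: ifPn => [|_]; last by rewrite normr0.
  by rewrite inE => /fd /le_trans; apply; exact: ler_norm.
apply/(measurable_restrictT _ (measurable_elt t)).
apply: (@eq_measurable_fun _ _ _ _ _ (fun x : R * R => a + b * x.1 + c * x.2)).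
  by move=> x; rewrite inE => /fE.
apply: measurable_funTS; apply: measurable_funD.
  apply: measurable_funD; first exact: measurable_cst.
  by apply: measurable_funM => //; exact: measurable_fst.
by apply: measurable_funM => //; exact: measurable_snd.
Qed.

(** * Energy and mass norms as quadratic forms *)

Lemma sub_neighborhood (R : realType) (D : set (R * R)) (TH : mesh R)
    (i : 'I_(nvert TH)) :
  conforming_partition D TH -> neighborhood i `<=` D.
Proof. by move=> [_ _ eltD _ _] x [K /= [KTH _] Kx]; exact: (eltD _ KTH). Qed.

Lemma measurable_neighborhood (R : realType) (TH : mesh R) (i : 'I_(nvert TH)) :
  measurable (neighborhood i : set (measurableTypeR R * measurableTypeR R)).
Proof.
by apply: open_measurable2; apply: bigcup_open => K _; exact: open_interior.
Qed.

Section norms.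
Variables (R : realType) (D omega : set (R * R)) (kappa : R * R -> R).
Variable Th : mesh R.
Hypotheses (oD : open D) (omegaD : omega `<=` D).
Hypothesis momega :
  measurable (omega : set (measurableTypeR R * measurableTypeR R)).
Hypotheses (kappa0 : forall x, D x -> 0 < kappa x).
Hypothesis ikappa : leb2.-integrable D (EFin \o kappa).

Let integrable_kappaM h : bounded_measurable h ->
  leb2.-integrable omega (EFin \o (fun x => kappa x * h x)).
Proof.
exact: integrable_bounded_measurable (open_measurable2 oD) momega omegaD ikappa.
Qed.

Lemma dot_ge0 (u : R * R) : 0 <= dot u u.
Proof. by rewrite /dot addr_ge0// -expr2 sqr_ge0. Qed.

Section nodal.
Variables (n : nat) (node : 'I_n -> 'I_(nvert Th)) (phi : 'I_n -> R * R -> R).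
Hypothesis phib : forall j, nodal_basis (node j) (phi j).

Let phi_affine j t : t \in elements Th -> affine_on (elt t) (phi j).
Proof.
move=> tTh; have [/(_ _ tTh)[a [b [c phiE]]] _] := phib j.
by exists a, b, c => x /interior_subset; exact: phiE.
Qed.

Lemma sqr_norm_A (z : 'rV[R]_n) :
  norm_A Th omega kappa phi z ^+ 2 =
  (z *m stiffness Th omega kappa phi *m z^T) 0 0.
Proof.
rewrite /norm_A sqr_sqrtr; last first.
  apply: Rintegral_ge0 => x /omegaD Dx.
  by rewrite mulr_ge0 ?dot_ge0// ltW// kappa0.
rewrite -(Rintegral_quad _ momega) => [|j k]; last first.
  apply: integrable_kappaM.
  by apply: dot_grad_bounded_measurable => t; exact: phi_affine.
apply: eq_Rintegral => x _; rewrite grad_fe_fun// /dot/=.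
rewrite !mulr_suml -big_split/= mulr_sumr; apply: eq_bigr => j _.
rewrite !mulr_sumr -big_split/= mulr_sumr; apply: eq_bigr => k _.
by ring.
Qed.

Variables (I : finType) (chi : I -> R * R -> R).
Hypothesis chiaff : forall i t, t \in elements Th -> affine_on (elt t) (chi i).

Lemma mass_integrand_ge0 (z : 'rV[R]_n) x : omega x ->
  0 <= kappa_tilde Th chi kappa x * fe_fun phi z x ^+ 2.
Proof.
move=> /omegaD Dx; rewrite mulr_ge0 ?sqr_ge0// sumr_ge0// => i _.
by rewrite mulr_ge0 ?dot_ge0// ltW// kappa0.
Qed.

Lemma sqr_norm_M (z : 'rV[R]_n) :
  norm_M omega (kappa_tilde Th chi kappa) phi z ^+ 2 =
  \int[leb2]_(x in omega)
    (kappa_tilde Th chi kappa x * `|fe_fun phi z x| ^+ 2).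
Proof.
rewrite /norm_M sqr_sqrtr; last first.
  by apply: Rintegral_ge0 => x; exact: mass_integrand_ge0.
by apply: eq_Rintegral => x _; rewrite real_normK ?num_real.
Qed.

(** Nothing is known of the nodal functions off the closed triangles, but the
    weight, being built from gradients, vanishes off the open ones; so each
    entry is kappa times a bounded measurable function of the whole plane. *)
Lemma Rintegral_mass (z : 'rV[R]_n) :
  \int[leb2]_(x in omega)
    (kappa_tilde Th chi kappa x * `|fe_fun phi z x| ^+ 2) =
  (z *m mass omega (kappa_tilde Th chi kappa) phi *m z^T) 0 0.
Proof.
pose G x := \sum_i dot (grad Th (chi i) x) (grad Th (chi i) x).
have ktE x : kappa_tilde Th chi kappa x = kappa x * G x by rewrite mulr_sumr.
have Gbm : bounded_measurable G.
  apply: bounded_measurable_sum => i.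
  by apply: dot_grad_bounded_measurable => t; exact: chiaff.
rewrite -(Rintegral_quad _ momega) => [|j k]; last first.
  rewrite (_ : (fun _ => _) =
      fun x => kappa x * (G x * (phi j x * phi k x))); last first.
    by apply/funext => x; rewrite ktE -mulrA.
  apply: integrable_kappaM; apply: (@piecewise_bounded_measurable _ Th).
    move=> t tTh.
    have phih j' : exists2 h, bounded_measurable h &
        forall x, elt t x -> phi j' x = h x.
      apply: affine_bounded_measurable_restrict; first exact: phi_affine.
      by exists 1 => x /interior_subset; exact: nodal_basis_le1.
    have [hj bj jE] := phih j; have [hk bk kE] := phih k.
    exists (fun x => G x * (hj x * hk x)) => [|x tx]; last by rewrite jE// kE.
    by do 2 apply: bounded_measurableM => //.
  move=> x nx; rewrite /G big1 ?mul0r// => i _.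
  by rewrite grad_skeleton// /dot/= mulr0 addr0.
apply: eq_Rintegral => x _; rewrite real_normK ?num_real// expr2 /fe_fun.
move: (kappa_tilde _ _ _ _) => c; rewrite mulr_suml mulr_sumr; apply: eq_bigr => j _.
rewrite !mulr_sumr; apply: eq_bigr => k _.
by ring.
Qed.

End nodal.
End norms.

(** * The error bound *)

Unset Implicit Arguments.
Set Strict Implicit.

Theorem lemma2 (R : realType) (L : R) :
  exists C : R, 0 < C /\
  forall (D : set (R * R)) (kappa : R * R -> R) (TH Th : mesh R)
    (chi : 'I_(nvert TH) -> R * R -> R) (i : 'I_(nvert TH))
    (k l q n : nat) (node : 'I_n -> 'I_(nvert Th)) (phi : 'I_n -> R * R -> R)
    (Psi : 'M[R]_(k + q, n)) (U : 'M[R]_(k + q)) (lambda : nat -> R)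
    (d : measure_display) (Omega : measurableType d) (P : probability Omega R)
    (Rc : 'I_l * 'I_(k + q) -> {RV P >-> R}),
  let m := (k + q)%N in
  let omega := neighborhood i in
  let kt := kappa_tilde Th chi kappa in
  let A := stiffness Th omega kappa phi in
  let M := mass omega kt phi in
  domain D ->
  (forall x, D x -> 0 < kappa x) ->
  leb2.-integrable D (EFin \o kappa) ->
  conforming_partition D TH -> triangulation D Th -> refines Th TH ->
  fine_partition_of_unity Th chi ->
  injective node ->
  (forall v, closure omega (vert v) <-> exists j, node j = v) ->
  (forall j, nodal_basis (node j) (phi j)) ->
  posdef M ->
  (k < l)%N -> (l < m)%N -> (m < n)%N ->
  \rank Psi = m ->
  iid_gaussian Rc ->
  (* lambda is indexed from 1 *)
  U^T *m Psi *m M *m Psi^T *m U = diag_mx (\row_(j < m) (lambda j.+1)^-1) ->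
  U^T *m Psi *m A *m Psi^T *m U = 1%:M ->
  (forall j j' : nat, (1 <= j <= j')%N -> (j' <= m)%N ->
     (lambda j')^-1 <= (lambda j)^-1) ->
  lambda k.+1 <= L ->
  forall w : Omega,
  let Rw := realization Rc w in
  let Psir := Rw *m Psi in
  let H := lsubmx (Rw *m (invmx U)^T) : 'M[R]_(l, k) in
  let S := rsubmx (Rw *m (invmx U)^T) : 'M[R]_(l, q) in
  \rank H = k ->
  forall xi : 'cV[R]_m, exists xir : 'cV[R]_l,
    let z := xi^T *m Psi - xir^T *m Psir in
    norm_M omega kt phi z ^+ 2 =
      \int[leb2]_(x in omega) (kt x * `|fe_fun phi z x| ^+ 2) /\
    \int[leb2]_(x in omega) (kt x * `|fe_fun phi z x| ^+ 2) <=
      C * ((spectral_norm (pseudo_inverse H *m S) + 1) / lambda k.+1) ^+ 2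
        * norm_A Th omega kappa phi (xi^T *m Psi) ^+ 2.
Proof.
exists (Num.max L 1); split; first by rewrite lt_max ltr01 orbT.
move=> D kappa TH Th chi i k l q n node phi Psi U lambda d Omega P Rc m omega
  kt A M [oD _ _] kappa0 ikappa cTH _ _ chiP _ _ phib Mpos kl lm _ rPsi _ UMU
  UAU lambda_dec lambdaL w Rw Psir H S rH xi.
have Uu : U \in unitmx by case: (mulmx1_unit UAU).
have omegaD : omega `<=` D := sub_neighborhood cTH.
have momega := measurable_neighborhood i.
have chiaff i' t : t \in elements Th -> affine_on (elt t) (chi i').
  by move=> /chiP[].
(* the mode number k + 1 exists, as k < l < k + q *)
have q0 : (0 < q)%N by move: lm; rewrite /m; case: q {Psi U Rc UMU UAU Uu rPsi
  lambda_dec m Rw Psir H S rH xi Mpos} => //; rewrite addn0 ltnNge (ltnW kl).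
have lambda_gt0 : 0 < lambda k.+1.
  have := posdef_diag_gt0 Mpos rPsi Uu UMU (rshift k (Ordinal q0)).
  by rewrite mxE/= addn0 invr_gt0.
have lambdaVge0 : 0 <= (lambda k.+1)^-1 by rewrite invr_ge0 ltW.
have [|xir xirP] := randomized_truncation (Rw := Rw) UMU UAU lambdaVge0 _ rH xi.
  move=> j; rewrite mxE/=; apply: lambda_dec; rewrite ?ltnS ?leq_addr//.
  by rewrite /m -addnS leq_add2l.
exists xir => z; split; first exact: (sqr_norm_M Th omegaD kappa0).
rewrite (Rintegral_mass oD omegaD momega ikappa phib chiaff).
rewrite (sqr_norm_A oD omegaD momega kappa0 ikappa phib).
apply: le_trans xirP _; rewrite ler_wpM2r//.
  by rewrite -(sqr_norm_A oD omegaD momega kappa0 ikappa phib) sqr_ge0.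
(* 1 / lambda <= max(L, 1) / lambda^2 because lambda <= L *)
have scale (s : R) :
    (lambda k.+1)^-1 * s ^+ 2 <= Num.max L 1 * (s / lambda k.+1) ^+ 2.
  rewrite exprMn (mulrCA (Num.max L 1)) [leLHS]mulrC ler_wpM2l ?sqr_ge0//.
  rewrite expr2 mulrA ler_peMl// ler_pdivlMr// mul1r.
  by rewrite le_max lambdaL.
exact: scale.
Qed.
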